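(* Let $f\colon X\to X$ be a cw-expansive homeomorphism of a compact metric space $X$. Then there is a function $D\colon E\to\mathbb{R}$ satisfying the following conditions. (1) Metric properties: (a) $D(C_{(p,q)})\ge 0$ for every $C_{(p,q)}\in E$, with equality if and only if $C$ is a singleton; (b) $D(C_{(p,q)})=D(C_{(q,p)})$ for every $C_{(p,q)}\in E$; (c) $D([A\cup B]_{(a,c)})\le D(A_{(a,b)})+D(B_{(b,c)})$ for all $A,B\in\mathcal{C}(X)$ and all $a\in A$, $b\in A\cap B$, $c\in B$. (2) Hyperbolicity: there exist constants $\lambda\in(0,1)$ and $\varepsilon>0$ such that (a) if $C\in\mathcal{C}^s_\varepsilon(X)$ and $p,q\in C$, then $D(f^n(C_{(p,q)}))\le 4\lambda^n D(C_{(p,q)})$ for every $n\ge0$; (b) if $C\in\mathcal{C}^u_\varepsilon(X)$ and $p,q\in C$, then $D(f^{-n}(C_{(p,q)}))\le 4\lambda^n D(C_{(p,q)})$ for every $n\ge0$. (3) Compatibility: for each $\delta>0$ there is $\gamma>0$ such that, for every $C\in\mathcal{C}(X)$, (a) if $\operatorname{diam}(C)<\gamma$, then $D(C_{(p,q)})<\delta$ for every $p,q\in C$; (b) if there exist $p,q\in C$ such that $D(C_{(p,q)})<\gamma$, then $\operatorname{diam}(C)<\delta$.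
   Context: Let $f$ be a homeomorphism of a compact metric space $(X,d)$. For $c>0$ and $x\in X$ put $W^s_c(x)=\{y\in X: d(f^n(x),f^n(y))\le c \text{ for all } n\ge 0\}$ and $W^u_c(x)=\{y\in X: d(f^{-n}(x),f^{-n}(y))\le c \text{ for all } n\ge 0\}$. $f$ is cw-expansive if there is $c>0$ such that $W^u_c(x)\cap W^s_c(x)$ is totally disconnected for every $x\in X$. $\mathcal{C}(X)$ denotes the set of all subcontinua (nonempty compact connected subsets) of $X$. Define $E=\{(p,q,C): C\in\mathcal{C}(X),\ p,q\in C\}$ and, for $p,q\in C\in\mathcal{C}(X)$, write $C_{(p,q)}=(p,q,C)$. For $C_{(p,q)}\in E$ and $n\in\mathbb{Z}$ put $f^n(C_{(p,q)})=f^n(C)_{(f^n(p),f^n(q))}$. For $\varepsilon>0$ let $\mathcal{C}^s_\varepsilon(X)=\{C\in\mathcal{C}(X):\operatorname{diam}(f^n(C))\le\varepsilon \text{ for every } n\ge0\}$ and $\mathcal{C}^u_\varepsilon(X)=\{C\in\mathcal{C}(X):\operatorname{diam}(f^{-n}(C))\le\varepsilon \text{ for every } n\ge0\}$. *)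

(* Defs.v *)
From HB Require Import structures.
From mathcomp Require Import all_boot all_order all_algebra.
From mathcomp Require Import all_classical all_reals.
From mathcomp Require Import topology metric_structure.

Set Implicit Arguments.
Unset Strict Implicit.
Unset Printing Implicit Defensive.

Import Order.TTheory GRing.Theory Num.Theory.

Local Open Scope classical_set_scope.
Local Open Scope ring_scope.

(* The inverse is carried as data so that negative iterates can be written
   without choice; it is determined by [homeo_fun]. *)
Record homeo (X : topologicalType) := Homeo {
  homeo_fun :> X -> X;
  homeo_inv : X -> X;
  homeo_funK : cancel homeo_fun homeo_inv;
  homeo_invK : cancel homeo_inv homeo_fun;
  homeo_continuous : continuous homeo_fun;
  homeo_inv_continuous : continuous homeo_inv }.

(* f^n for n in Z; [Negz m] stands for -(m + 1). *)
Definition ziter (X : topologicalType) (f : homeo X) (n : int) : X -> X :=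
  match n with
  | Posz m => iter m f
  | Negz m => iter m.+1 (homeo_inv f)
  end.

Lemma iter_continuous (X : topologicalType) (g : X -> X) (n : nat) :
  continuous g -> continuous (iter n g).
Proof.
move=> cg; elim: n => [|n IHn] x; first exact: cvg_id.
exact: (continuous_comp (IHn x) (cg _)).
Qed.

Lemma ziter_continuous (X : topologicalType) (f : homeo X) (n : int) :
  continuous (ziter f n).
Proof.
case: n => n; first exact/iter_continuous/homeo_continuous.
exact: (@iter_continuous _ _ n.+1 (@homeo_inv_continuous _ f)).
Qed.

(* For C of a type that coerces to [set X], [C x] is membership. *)
Identity Coercion set_to_fun : set >-> Funclass.

(* The set C(X) of subcontinua of X, as a type. *)
Record continuum (X : topologicalType) := Continuum {
  continuum_set :> set X;
  continuum_neq0 : continuum_set !=set0;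
  continuum_compact : compact continuum_set;
  continuum_connected : connected continuum_set }.

Lemma image_neq0 (T U : Type) (g : T -> U) (A : set T) :
  A !=set0 -> g @` A !=set0.
Proof. by case=> x Ax; exists (g x), x. Qed.

Lemma image_compact (X Y : topologicalType) (g : X -> Y) (A : set X) :
  continuous g -> compact A -> compact (g @` A).
Proof. by move=> cg; apply: continuous_compact; apply: continuous_subspaceT. Qed.

Lemma image_connected (X Y : topologicalType) (g : X -> Y) (A : set X) :
  continuous g -> connected A -> connected (g @` A).
Proof.
by move=> cg cA; apply: connected_continuous_connected => //;
  apply: continuous_subspaceT.
Qed.

Definition continuum_image (X : topologicalType) (f : homeo X) (n : int)
    (C : continuum X) : continuum X :=
  Continuum (image_neq0 (ziter f n) (continuum_neq0 C))
    (image_compact (@ziter_continuous _ f n) (@continuum_compact _ C))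
    (image_connected (@ziter_continuous _ f n) (@continuum_connected _ C)).

Lemma setU_neq0 (T : Type) (A B : set T) : A !=set0 -> A `|` B !=set0.
Proof. by case=> x Ax; exists x; left. Qed.

Definition continuumU (X : topologicalType) (A B : continuum X)
    (AB : (A `&` B) !=set0) : continuum X :=
  Continuum (setU_neq0 B (continuum_neq0 A))
    (compactU (@continuum_compact _ A) (@continuum_compact _ B))
    (connectedU AB (@continuum_connected _ A) (@continuum_connected _ B)).

(* The set E: [Mark C p q _ _] is C_(p,q) = (p, q, C). *)
Record marked_continuum (X : topologicalType) := Mark {
  mcarrier : continuum X;
  mfst : X;
  msnd : X;
  mfst_in : mcarrier mfst;
  msnd_in : mcarrier msnd }.
Arguments Mark {X} mcarrier mfst msnd mfst_in msnd_in.

(* f^n(C_(p,q)) = f^n(C)_(f^n(p), f^n(q)) *)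
Definition mark_image (X : topologicalType) (f : homeo X) (n : int)
    (e : marked_continuum X) : marked_continuum X :=
  Mark (continuum_image f n (mcarrier e))
    (ziter f n (mfst e)) (ziter f n (msnd e))
    (imageP (ziter f n) (mfst_in e)) (imageP (ziter f n) (msnd_in e)).

(* [A u B]_(a,c), for a in A, b in A n B, c in B *)
Definition markU (X : topologicalType) (A B : continuum X) (a b c : X)
    (aA : A a) (bA : A b) (bB : B b) (cB : B c) : marked_continuum X :=
  Mark (continuumU (ex_intro (A `&` B) b (conj bA bB)))
    a c (or_introl aA) (or_intror cB).
Arguments markU {X} A B a b c aA bA bB cB.

Section metric.
Context {R : realType} {X : metricType R}.
Implicit Types (f : homeo X) (c e : R) (x : X).

(* [sup] is the true supremum only on nonempty bounded sets; this is the case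
   for nonempty A in a compact X. *)
Definition diam (A : set X) : R :=
  sup [set mdist xy.1 xy.2 | xy in A `*` A].

Definition Ws f c x : set X :=
  [set y | forall n : nat, mdist (ziter f n%:Z x) (ziter f n%:Z y) <= c].

Definition Wu f c x : set X :=
  [set y | forall n : nat, mdist (ziter f (- n%:Z) x) (ziter f (- n%:Z) y) <= c].

Definition cw_expansive f : Prop :=
  exists2 c, 0 < c & forall x, totally_disconnected (Wu f c x `&` Ws f c x).

Definition Cs f e : set (continuum X) :=
  [set C | forall n : nat, diam (continuum_image f n%:Z C) <= e].

Definition Cu f e : set (continuum X) :=
  [set C | forall n : nat, diam (continuum_image f (- n%:Z) C) <= e].

End metric.

(* Main.v *)
Require Import Defs.
From HB Require Import structures.
From mathcomp Require Import all_boot all_order all_algebra.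
From mathcomp Require Import all_classical all_reals.
From mathcomp Require Import topology metric_structure normedtype sequences.
From mathcomp Require Import zify lra.

Set Implicit Arguments.
Unset Strict Implicit.
Unset Printing Implicit Defensive.

Import Order.TTheory GRing.Theory Num.Theory.
Import numFieldNormedType.Exports.

Local Open Scope classical_set_scope.
Local Open Scope ring_scope.

(** Fix a cw-expansivity constant [c] and call a set [A] small up to time [n]
    when [f^i(A)] has diameter at most [c] for all [|i| < n].  With
    [0 < lam < 1], the number [dsize A = inf {lam^n | A small up to time n}]
    measures [A] by how long its orbit takes to show it at scale [c].  It has
    all the required properties except the triangle inequality.

    - Hyperbolicity is built in: when the forward orbit of [A] never exceeds
      [c], only negative times limit its smallness, and replacing [A] by
      [f^k(A)] moves these times [k] steps away, so [dsize] is multiplied by at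
      most [lam^k] ([dsize_stable], [dsize_unstable]).
    - Compatibility with the diameter is uniform continuity of finitely many
      iterates in one direction ([diam_dsize]).  In the other direction it is
      uniform expansivity ([uniform_expansivity]): a connected set that is
      small up to a large time has small diameter.  Otherwise an ultralimit of
      counterexamples would be a nondegenerate connected set whose whole orbit
      stays within [c], contained in some
      [W^u_c(x) `&` W^s_c(x)] ([connected_limit_set]).
    - Uniform expansivity at scale [c / 3] also gives a time [m] such that
      three consecutive meeting connected sets, all small up to time [n], have
      a union small up to time [n - m].  Choosing [lam] with [lam^m >= 1/2]
      yields [dsize (A u B u C) <= 2 * max] ([dsize_union3]).

    Such a quasi-triangle inequality can be repaired by chains, as in Frink's
    metrization lemma: let [D(C_(p,q))] be the infimum of the sums of [dsize]
    over the finite chains of continua that lead from [p] to [q] and have union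
    [C].  Concatenating and reversing chains gives the metric properties, and
    cutting a chain at half of its total cost shows
    [D <= dsize C <= 2 D] ([rho_chain_union]).  Hence [D] inherits
    compatibility from [dsize], and hyperbolicity with a constant at most 4,
    the factor 2 separating [D] from [dsize] being the only loss. *)

(** * Ultralimits of connected sets *)

Section ultralimit.
Context {I : Type} {F : set_system I}.
Context {FP : ProperFilter F} (FF : UltraFilter F).

Lemma ultra_cvg (T : topologicalType) (x_ : I -> T) :
  compact [set: T] -> exists x : T, x_ @ F --> x.
Proof.
move=> cT; have [x [_ clx]] := cT (x_ @ F) _ filterT.
exists x => U xU.
have [//|FU] := @in_ultra_setVsetC _ F (x_ @^-1` U) FF.
by have [y [nUy /nUy]] := clx (~` U) U FU xU.
Qed.

(** The limit of the family [C_] along [F]; when [F] is an ultrafilter on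
    indices this replaces the compactness of the hyperspace of continua. *)
Definition limit_set (T : topologicalType) (C_ : I -> set T) : set T :=
  [set x | forall U, nbhs x U -> \forall m \near F, U `&` C_ m !=set0].

Lemma limit_set_cvg (T : topologicalType) (C_ : I -> set T) (x_ : I -> T) x :
  (\forall m \near F, C_ m (x_ m)) -> x_ @ F --> x -> limit_set C_ x.
Proof.
move=> Cx xx U xU; have xF : F (x_ @^-1` U) := xx _ xU.
by apply: filterS (filterI xF Cx) => m [? ?]; exists (x_ m).
Qed.

Lemma closed_limit_set (T : topologicalType) (C_ : I -> set T) :
  closed (limit_set C_).
Proof.
move=> x clx U xU.
have [y [Ly yU]] := clx _ (nbhs_interior xU).
exact: Ly.
Qed.

(** If the limit split into two nonempty closed pieces, normality would enclose
    them in disjoint open sets [U] and [V].  Almost every [C_ m] meets both, so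
    being connected it sticks out of [U `|` V]; a limit of points sticking out
    would be a point of the limit set outside [U `|` V]. *)
Lemma connected_limit_set (T : topologicalType) (C_ : I -> set T) :
  hausdorff_space T -> compact [set: T] -> (forall m, connected (C_ m)) ->
  connected (limit_set C_).
Proof.
move=> hT cT conC B [b Bb] [O oO BO] [K cK BK].
set L := limit_set C_ in BO BK *.
have clL : closed L := closed_limit_set (C_ := C_).
have clB : closed B by rewrite BK; exact: closedI.
pose A := L `&` ~` O.
have clA : closed A by apply: closedI => //; exact: open_closedC.
apply/seteqP; split => [x|x Lx]; first by rewrite BO => -[].
apply: contrapT => nBx.
have Ax : A x by split => // Ox; apply: nBx; rewrite BO.
have AB : set_nbhs A (~` B).
  move=> y [Ly Oy]; apply: open_nbhs_nbhs; split; first exact: closed_openC.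
  by rewrite BO => -[].
have [P PA clP] := compact_normal hT cT clA AB.
pose U := P°; pose V := ~` closure P.
have UV : separated U V.
  split.
    apply/disjoints_subset; rewrite setCK.
    by apply: closure_subset; exact: interior_subset.
  apply/disjoints_subset => y Uy; rewrite -interiorC setCK.
  by apply: filterS Uy => z; exact: subset_closure.
have AU : A `<=` U by move=> y Ay; exact: PA.
have BV : B `<=` V by move=> y By /clP; apply.
have oU : open U := open_interior P.
have oV : open V by apply: closed_openC; exact: closed_closure.
have meetU : \forall m \near F, U `&` C_ m !=set0.
  by apply: Lx; apply: open_nbhs_nbhs; split => //; exact: AU.
have meetV : \forall m \near F, V `&` C_ m !=set0.
  have Lb : L b by move: Bb; rewrite BO => -[].
  by apply: Lb; apply: open_nbhs_nbhs; split => //; exact: BV.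
have cover : \forall m \near F, C_ m `<=` U `|` V.
  have [//|] := @in_ultra_setVsetC _ F [set m | C_ m `<=` U `|` V] FF.
  move=> Fn; exfalso.
  have [z_ zP] : {z_ : I -> T & forall m, ~ (C_ m `<=` U `|` V) ->
      C_ m (z_ m) /\ ~ (U `|` V) (z_ m)}.
    apply: (@choice _ _ (fun m z => ~ (C_ m `<=` U `|` V) ->
      C_ m z /\ ~ (U `|` V) z)) => m.
    have [?|/existsNP[z /not_implyP zz]] := pselect (C_ m `<=` U `|` V).
      by exists x.
    by exists z.
  have [z zz] := ultra_cvg z_ cT.
  have Lz : L z by apply: limit_set_cvg zz; apply: filterS Fn => m /zP[].
  have UVz : (U `|` V) z.
    have [Oz|nOz] := pselect (O z); last by left; apply: AU.
    by right; apply: BV; rewrite BO.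
  have zUV : nbhs z (U `|` V).
    by apply: open_nbhs_nbhs; split => //; exact: openU.
  have Fz : F (z_ @^-1` (U `|` V)) := zz _ zUV.
  by have [m [/zP[_ ?]]] := filter_ex (filterI Fn Fz).
have [m [[[u [Uu Cu]] [v [Vv Cv]]] CUV]] :=
  filter_ex (filterI (filterI meetU meetV) cover).
have dUV := separated_disjoint UV.
have [CU|CV] := connected_subset UV CUV (conC m).
  have : (U `&` V) v by split => //; exact: CU.
  by rewrite dUV.
have : (U `&` V) u by split => //; exact: CV.
by rewrite dUV.
Qed.

End ultralimit.

Section metric_limit.
Context {R : realType} {X : metricType R}.

Lemma cvg_mdist_near {I : Type} {F : set_system I} {FF : ProperFilter F}
    (x_ y_ : I -> X) x y e : 0 < e -> x_ @ F --> x -> y_ @ F --> y ->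
  \forall m \near F, `|mdist (x_ m) (y_ m) - mdist x y| < e.
Proof.
move=> e0 xx yy; have e20 : 0 < e / 2 by rewrite divr_gt0.
have xF : F (x_ @^-1` ball x (e / 2)) := xx _ (nbhsx_ballx x _ e20).
have yF : F (y_ @^-1` ball y (e / 2)) := yy _ (nbhsx_ballx y _ e20).
apply: filterS (filterI xF yF) => m [].
rewrite /= !ballEmdist /= => xm ym.
have h1 := metric_triangle (x_ m) x (y_ m).
have h2 := metric_triangle x y (y_ m).
have h3 := metric_triangle x (x_ m) y.
have h4 := metric_triangle (x_ m) (y_ m) y.
move: h1 h4; rewrite (metric_sym (x_ m) x) (metric_sym (y_ m) y) => h1 h4.
by rewrite ltr_norml; apply/andP; split; lra.
Qed.

(** Each argument by contradiction from compactness takes a sequence of pairs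
    of points and passes to the limit along one common ultrafilter. *)
Lemma compact_ultra_pair (x_ y_ : nat -> X) : compact [set: X] ->
  exists F : set_system nat, [/\ ProperFilter F, UltraFilter F, \oo `<=` F &
    exists x y : X, x_ @ F --> x /\ y_ @ F --> y].
Proof.
move=> cX; have [F [FF ooF]] :=
  ultraFilterLemma (eventually_filter : ProperFilter \oo).
have FP : ProperFilter F := @ultra_proper _ _ FF.
exists F; split => //.
have [x xx] := ultra_cvg FF x_ cX; have [y yy] := ultra_cvg FF y_ cX.
by exists x, y.
Qed.

(** The metric form of the Heine-Cantor theorem. *)
Lemma compact_unif_continuous (g : X -> X) e : compact [set: X] ->
  continuous g -> 0 < e ->
  exists2 d, 0 < d & forall x y, mdist x y < d -> mdist (g x) (g y) < e.
Proof.
move=> cX cg e0; apply: contrapT => nd.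
have bad m : exists xy : X * X,
    mdist xy.1 xy.2 < m.+1%:R^-1 /\ e <= mdist (g xy.1) (g xy.2).
  apply: contrapT => H; apply: nd; exists m.+1%:R^-1; first by rewrite invr_gt0.
  move=> x y xy; rewrite ltNge; apply/negP => exy; apply: H.
  by exists (x, y).
have [xy_ xyP] := choice bad.
have [F [FP _ ooF [x [y [xx yy]]]]] :=
  compact_ultra_pair (fst \o xy_) (snd \o xy_) cX.
have xy : x = y.
  apply/mdist_positivity/eqP; rewrite eq_le mdist_ge0 andbT.
  apply/ler_addgt0Pl => r r0; rewrite addr0.
  have r20 : 0 < r / 2 by rewrite divr_gt0.
  pose N := Num.truncn (r / 2)^-1.
  have NP m : (N <= m)%N -> m.+1%:R^-1 < r / 2.
    move=> Nm; rewrite invf_plt ?posrE //.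
    by apply: lt_le_trans (truncnS_gt _) _; rewrite ler_nat.
  have FN : F [set m | (N <= m)%N] by apply: ooF; exists N.
  have [m [/= /NP mr]] := filter_ex (filterI FN (cvg_mdist_near r20 xx yy)).
  rewrite ltr_norml /= => /andP[h _].
  have [/= h1 _] := xyP m; have := lt_trans h1 mr; clear h1 mr NP; lra.
have gx : (g \o (fst \o xy_)) @ F --> g x by apply: cvg_comp xx (cg x).
have gy : (g \o (snd \o xy_)) @ F --> g x.
  by rewrite xy; apply: cvg_comp yy (cg y).
have [m /=] := filter_ex (cvg_mdist_near e0 gx gy).
rewrite mdistxx subr0 ger0_norm ?mdist_ge0 // => h.
by have [_ /=] := xyP m; lra.
Qed.

Lemma compact_mdist_bounded : compact [set: X] ->
  exists M, forall x y : X, mdist x y <= M.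
Proof.
move=> cX; apply: contrapT => nM.
have bad (m : nat) : exists xy : X * X, m%:R < mdist xy.1 xy.2.
  apply: contrapT => H; apply: nM; exists m%:R => x y.
  by rewrite leNgt; apply/negP => xy; apply: H; exists (x, y).
have [xy_ xyP] := choice bad.
have [F [FP _ ooF [x [y [xx yy]]]]] :=
  compact_ultra_pair (fst \o xy_) (snd \o xy_) cX.
pose N := (Num.truncn (mdist x y + 1)).+1.
have FN : F [set m | (N <= m)%N] by apply: ooF; exists N.
have [m [/= Nm]] := filter_ex (filterI FN (cvg_mdist_near ltr01 xx yy)).
rewrite ltr_norml /= => /andP[_ h].
have := truncnS_gt (mdist x y + 1); rewrite -/N => h1.
have : N%:R <= m%:R :> R by rewrite ler_nat.
have /= := xyP m; lra.
Qed.

Lemma diam_leP (A : set X) e : compact [set: X] -> A !=set0 ->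
  diam A <= e <-> forall x y, A x -> A y -> mdist x y <= e.
Proof.
move=> cX [a Aa]; have [M MP] := compact_mdist_bounded cX.
split => [dA x y Ax Ay|Ae].
  apply: le_trans dA; apply: ub_le_sup; last by exists (x, y).
  by exists M => _ [xy _ <-]; exact: MP.
apply: ge_sup; first by exists (mdist a a), (a, a).
by move=> _ [xy [? ?] <-]; exact: Ae.
Qed.

End metric_limit.

(** * A ratio with a prescribed power above one half *)

Section geometric.
Context {R : realType}.
Implicit Types lam e : R.

Lemma expr_small lam e : 0 < lam < 1 -> 0 < e -> exists n, lam ^+ n < e.
Proof.
move=> /andP[l0 l1] e0.
have l1' : `|lam| < 1 by rewrite gtr0_norm.
have /cvgrPdist_lt h := cvg_expr l1'.
have [N _ /(_ N (leqnn N))] := h _ e0.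
rewrite /= sub0r normrN gtr0_norm ?exprn_gt0 // => ?.
by exists N.
Qed.

Lemma bernoulli (x : R) n : 0 <= x <= 1 -> 1 - n%:R * x <= (1 - x) ^+ n.
Proof.
move=> /andP[x0 x1]; elim: n => [|n IHn]; first by rewrite expr0; lra.
rewrite exprS -natr1.
have n0 : 0 <= n%:R :> R by [].
have : (1 - x) * (1 - n%:R * x) <= (1 - x) * (1 - x) ^+ n.
  by rewrite ler_wpM2l //; lra.
by apply: le_trans; nra.
Qed.

Lemma half_root n : exists2 lam : R, 0 < lam < 1 & 1 / 2 <= lam ^+ n.
Proof.
(* By Bernoulli's inequality (1 - x)^n >= 1 - n x, it suffices that
   (n + 1) x = 1/2; the shift makes x well defined for n = 0. *)
pose x : R := (2 * n.+1%:R)^-1.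
have n0 : 0 < n%:R + 1 :> R by rewrite natr1.
have x0 : 0 < x by rewrite invr_gt0 mulr_gt0.
have nx : n.+1%:R * x = 1 / 2.
  by rewrite /x invfM mulrCA mulfV ?mulr1 ?div1r // pnatr_eq0.
have x1 : x <= 1 / 2.
  by rewrite -nx -natr1; have : 0 <= n%:R :> R by []; nra.
exists (1 - x); first by apply/andP; split; lra.
apply: le_trans (bernoulli n _); last by apply/andP; split; lra.
have := nx; rewrite -natr1; lra.
Qed.

End geometric.

(** * Iterates *)

Section iterates.
Context {X : topologicalType} (f : homeo X).

Lemma ziterS i x : ziter f (i + 1) x = f (ziter f i x).
Proof.
case: i => [n|[|n]] /=; first by rewrite addn1.
  by rewrite homeo_invK.
by rewrite homeo_invK subn1.
Qed.

Lemma ziterV i x : ziter f (i - 1) x = homeo_inv f (ziter f i x).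
Proof. by rewrite -[i in RHS](subrK 1) ziterS homeo_funK. Qed.

Lemma ziterD i j x : ziter f (i + j) x = ziter f i (ziter f j x).
Proof.
elim/int_rec: i => [|n IHn|n IHn]; first by rewrite add0r.
  by rewrite -addn1 PoszD addrAC !ziterS IHn.
by rewrite -addn1 PoszD opprD addrAC !ziterV IHn.
Qed.

End iterates.

(** * Chains of continua and Frink's lemma *)

Section chains.
Context {R : realType} {X : topologicalType}.
Implicit Types (s t : seq (continuum X * X)) (p q r : X) (C : continuum X).

(** A chain is encoded by its links [(A, y)]: the continuum [A] is left through
    the point [y], which is where the next link is entered. *)
Fixpoint linked p q s : Prop :=
  if s is (A, y) :: s' then [/\ A p, A y & linked y q s'] else p = q.

(** The starting point belongs to the union, so that the empty chain at [p] has
    the continuum [[set p]] as its union and splitting off an empty part of a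
    chain needs no separate treatment. *)
Fixpoint chain_union p s : set X :=
  if s is (A, y) :: s' then A `|` chain_union y s' else [set p].

Lemma linked_cat p q s t :
  linked p q (s ++ t) <-> exists2 r, linked p r s & linked r q t.
Proof.
elim: s p => [|[A y] s IHs] p /=.
  by split => [pq|[_ ->]//]; exists p.
split => [[Ap Ay /IHs[r yr rq]]|[r [Ap Ay yr] rq]]; first by exists r.
by split => //; apply/IHs; exists r.
Qed.

Lemma chain_union_fst p q s : linked p q s -> chain_union p s p.
Proof. by case: s => [|[A y] s] //= [Ap _ _]; left. Qed.

Lemma chain_union_snd p q s : linked p q s -> chain_union p s q.
Proof.
elim: s p => [|[A y] s IHs] p //= [_ _ /IHs]; by right.
Qed.

Lemma chain_union_cat p r q s t : linked p r s -> linked r q t ->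
  chain_union p (s ++ t) = chain_union p s `|` chain_union r t.
Proof.
elim: s p => [|[A y] s IHs] p /=; last first.
  by move=> [_ _ yr] rq; rewrite (IHs _ yr rq) setUA.
move=> -> rq; apply/seteqP; split => x; first by right.
by case=> [->|//]; exact: chain_union_fst rq.
Qed.

Lemma chain_union_connected p q s : linked p q s -> connected (chain_union p s).
Proof.
elim: s p => [|[A y] s IHs] p /=; first by move=> _; exact: connected1.
move=> [Ap Ay yq]; apply: connectedU; last exact: IHs.
  by exists y; split => //; exact: chain_union_fst yq.
exact: continuum_connected.
Qed.

Section cost.
Variable rho : set X -> R.

Definition cost s : R := \sum_(l <- s) rho l.1.

Lemma cost_cat s t : cost (s ++ t) = cost s + cost t.
Proof. by rewrite /cost big_cat. Qed.

(** Read backwards, each link is left through the point where it was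
    entered. *)
Lemma linked_rev p q s : linked p q s -> exists t,
  [/\ linked q p t, chain_union q t = chain_union p s & cost t = cost s].
Proof.
elim: s p => [|[A y] s IHs] p /=; first by move=> ->; exists [::].
move=> [Ap Ay /IHs[t [qy tE tc]]].
have yp : linked y p [:: (A, p)] by [].
exists (t ++ [:: (A, p)]); split.
- by apply/linked_cat; exists y.
- rewrite (chain_union_cat qy yp) tE /=.
  have -> : A `|` [set p] = A by apply/setUidl => _ ->.
  by rewrite setUC.
- by rewrite cost_cat tc /cost !big_cons big_nil addr0 addrC.
Qed.

Definition chain_metric (e : marked_continuum X) : R :=
  inf [set cost s | s in [set s | linked (mfst e) (msnd e) s /\
    chain_union (mfst e) s = mcarrier e]].

Hypothesis rho_ge0 : forall A, 0 <= rho A.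

Lemma cost_ge0 s : 0 <= cost s.
Proof. exact: sumr_ge0. Qed.

Lemma cost_lbound (E : set (seq (continuum X * X))) :
  has_lbound (cost @` E).
Proof. by exists 0 => _ [s _ <-]; exact: cost_ge0. Qed.

Lemma chain_metric_le p q C (pC : C p) (qC : C q) s :
  linked p q s -> chain_union p s = C ->
  chain_metric (Mark C p q pC qC) <= cost s.
Proof.
by move=> pq sC; apply: ge_inf; [exact: cost_lbound|exists s].
Qed.

Lemma chain_metric_approx p q C (pC : C p) (qC : C q) e :
  chain_metric (Mark C p q pC qC) < e ->
  exists s, [/\ linked p q s, chain_union p s = C & cost s < e].
Proof.
move=> /inf_lt[|_ [s [pq sC] <-] se]; last by exists s.
exists (cost [:: (C, q)]), [:: (C, q)] => //; split => //=.
by apply/setUidl => _ ->.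
Qed.

Lemma chain_metric_ge0 e : 0 <= chain_metric e.
Proof.
case: e => C p q pC qC; rewrite leNgt; apply/negP.
move=> /chain_metric_approx[s [_ _]]; by rewrite ltNge cost_ge0.
Qed.

Lemma chain_metric_le_rho C p q (pC : C p) (qC : C q) :
  chain_metric (Mark C p q pC qC) <= rho C.
Proof.
have -> : rho C = cost [:: (C, q)] by rewrite /cost big_seq1.
by apply: chain_metric_le => //=; apply/setUidl => _ ->.
Qed.

Lemma chain_metric_sym C p q (pC : C p) (qC : C q) :
  chain_metric (Mark C p q pC qC) = chain_metric (Mark C q p qC pC).
Proof.
wlog suff le : p q pC qC / chain_metric (Mark C p q pC qC) <=
                           chain_metric (Mark C q p qC pC).
  by apply/eqP; rewrite eq_le !le.
rewrite leNgt; apply/negP => /chain_metric_approx[s [qp sC]].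
have [t [pq tC <-]] := linked_rev qp.
by rewrite ltNge chain_metric_le // tC.
Qed.

Lemma chain_metric_triangle (A B : continuum X) a b c
    (aA : A a) (bA : A b) (bB : B b) (cB : B c) :
  chain_metric (markU A B a b c aA bA bB cB) <=
    chain_metric (Mark A a b aA bA) + chain_metric (Mark B b c bB cB).
Proof.
apply/ler_addgt0Pl => e e0.
have e20 : 0 < e / 2 by rewrite divr_gt0.
have [|s [ab sA sc]] := @chain_metric_approx a b A aA bA
  (chain_metric (Mark A a b aA bA) + e / 2); first by rewrite ltrDl.
have [|t [bc tB tc]] := @chain_metric_approx b c B bB cB
  (chain_metric (Mark B b c bB cB) + e / 2); first by rewrite ltrDl.
apply: (@le_trans _ _ (cost (s ++ t))); last by rewrite cost_cat; lra.
apply: chain_metric_le; first by apply/linked_cat; exists b.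
by rewrite (chain_union_cat ab bc) sA tB.
Qed.

Hypothesis rho_set1 : forall p, rho [set p] = 0.
(** Connected sets rather than continua: this is all that the chain argument
    propagates to unions of links. *)
Hypothesis rho_union3 : forall (A B C : set X) (h : R),
  connected A -> connected B -> connected C ->
  A `&` B !=set0 -> B `&` C !=set0 ->
  rho A <= h -> rho B <= h -> rho C <= h -> rho (A `|` B `|` C) <= 2 * h.

(** The link at which the accumulated cost crosses the level [h]. *)
Lemma cost_split s h : s <> [::] -> 0 <= h <= cost s ->
  exists s1 l s2, [/\ s = s1 ++ l :: s2, cost s1 <= h &
    h <= cost s1 + rho l.1].
Proof.
elim: s h => [//|l s IHs] h _ /andP[h0].
rewrite /cost big_cons -/(cost s) => hs.
have [hl|lh] := leP h (rho l.1).
  by exists [::], l, s; rewrite /cost big_nil add0r.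
have [s0|s0] := pselect (s = [::]).
  by move: hs; rewrite s0 /cost big_nil; lra.
have [|s1 [l' [s2 [-> s1h hs1]]]] := IHs (h - rho l.1) s0.
  by apply/andP; split; lra.
exists (l :: s1), l', s2; rewrite /cost big_cons -/(cost s1).
by split => //; lra.
Qed.

(** Frink's inequality, by induction on the length of the chain.  At the link
    where the cost crosses one half of the total [S], both remaining parts cost
    at most [S / 2], hence have size at most [S] by induction, as has the link
    itself; the quasi-triangle inequality for three sets then gives [2 * S]. *)
Lemma rho_chain_union p q s : linked p q s ->
  rho (chain_union p s) <= 2 * cost s.
Proof.
have [n sn] := ubnP (size s); elim: n s p q sn => // n IHn s p q sn pq.
have [s0|s0] := pselect (s = [::]).
  by rewrite s0 /cost big_nil /= rho_set1 mulr0.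
have S0 := cost_ge0 s.
have [|s1 [[A y] [s2 [sE s1h hs1]]]] := @cost_split s (cost s / 2) s0.
  by apply/andP; split; lra.
move: pq; rewrite sE => /linked_cat[r pr rq].
rewrite (chain_union_cat pr rq) /=.
case: (rq) => Ar Ay yq.
have costE : cost s = cost s1 + (rho A + cost s2).
  by rewrite sE cost_cat /cost big_cons.
have A0 := rho_ge0 A; have s10 := cost_ge0 s1; have s20 := cost_ge0 s2.
move: hs1 => /= hs1; move: sn; rewrite sE size_cat /= => sn.
have ns1 : (size s1 < n)%N by lia.
have ns2 : (size s2 < n)%N by lia.
have h1 := IHn _ _ _ ns1 pr; have h2 := IHn _ _ _ ns2 yq.
rewrite -sE setUA; apply: rho_union3.
- exact: chain_union_connected pr.
- exact: continuum_connected.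
- exact: chain_union_connected yq.
- by exists r; split => //; exact: chain_union_snd pr.
- by exists y; split => //; exact: chain_union_fst yq.
- lra.
- lra.
- lra.
Qed.

Lemma rho_le_chain_metric C p q (pC : C p) (qC : C q) :
  rho C <= 2 * chain_metric (Mark C p q pC qC).
Proof.
rewrite leNgt; apply/negP => h.
have [|s [pq sC]] := @chain_metric_approx p q C pC qC (rho C / 2).
  lra.
have := rho_chain_union pq; rewrite sC; lra.
Qed.

End cost.
End chains.

(** * Dynamical size of connected sets *)

Section expansive.
Context {R : realType} {X : metricType R}.
Hypothesis X_compact : compact [set: X].
Variable (f : homeo X) (c : R).

Definition small n (A : set X) := forall i : int, (`|i| < n)%N ->
  forall x y, A x -> A y -> mdist (ziter f i x) (ziter f i y) <= c.

Lemma small_leq m n A : (m <= n)%N -> small n A -> small m A.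
Proof. by move=> mn sA i im; apply: sA; exact: leq_trans im mn. Qed.

Hypothesis c_gt0 : 0 < c.
Hypothesis c_cw : forall x, totally_disconnected (Wu f c x `&` Ws f c x).

(** A connected set whose orbit stays within [c] for a long time is uniformly
    small.  An ultralimit [L] of connected counterexamples contains the two
    limit points [x <> y], and all of its iterates have diameter at most [c],
    so [L] lies in the totally disconnected set [W^u_c(x) `&` W^s_c(x)]. *)
Lemma uniform_expansivity e : 0 < e -> exists m, forall C, connected C ->
  small m C -> forall x y, C x -> C y -> mdist x y < e.
Proof.
move=> e0; apply: contrapT => nm.
have bad m : exists Cxy : set X * (X * X), [/\ connected Cxy.1, small m Cxy.1,
    Cxy.1 Cxy.2.1, Cxy.1 Cxy.2.2 & e <= mdist Cxy.2.1 Cxy.2.2].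
  apply: contrapT => H; apply: nm; exists m => C conC sC x y Cx Cy.
  by rewrite ltNge; apply/negP => exy; apply: H; exists (C, (x, y)).
have [w_ wP] := choice bad.
pose C_ m := (w_ m).1.
have [F [FP FF ooF [x [y [xx yy]]]]] :=
  compact_ultra_pair (fun m => (w_ m).2.1) (fun m => (w_ m).2.2) X_compact.
pose L := limit_set (F := F) C_.
have Lx : L x.
  by apply: limit_set_cvg xx; apply: filterE => m; have [] := wP m.
have Ly : L y.
  by apply: limit_set_cvg yy; apply: filterE => m; have [] := wP m.
have conL : connected L.
  apply: connected_limit_set => //; first exact: metric_hausdorff.
  by move=> m; have [] := wP m.
have cL i u v : L u -> L v -> mdist (ziter f i u) (ziter f i v) <= c.
  move=> Lu Lv; apply/ler_addgt0Pl => r r0.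
  have r20 : 0 < r / 2 by rewrite divr_gt0.
  have near_iter z : nbhs z (ziter f i @^-1` ball (ziter f i z) (r / 2)).
    by apply: ziter_continuous; exact: nbhsx_ballx.
  have FN : F [set m | (`|i|.+1 <= m)%N] by apply: ooF; exists `|i|.+1.
  have [m [[[u' [+ Cu]] [v' [+ Cv]]] /= im]] :=
    filter_ex (filterI (filterI (Lu _ (near_iter u)) (Lv _ (near_iter v))) FN).
  rewrite /= !ballEmdist /= => uu' vv'.
  have [_ sm _ _ _] := wP m.
  have := sm i im _ _ Cu Cv.
  have := metric_triangle (ziter f i u) (ziter f i u') (ziter f i v).
  have := metric_triangle (ziter f i u') (ziter f i v') (ziter f i v).
  rewrite (metric_sym (ziter f i v)) in vv'; lra.
have LW : L `<=` Wu f c x `&` Ws f c x.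
  by move=> z Lz; split => n; exact: cL.
have : connected_component (Wu f c x `&` Ws f c x) x y.
  exact: (connected_component_max Lx LW conL).
rewrite (c_cw (LW _ Lx)) => xy.
have [N [/=]] := filter_ex (cvg_mdist_near e0 xx yy).
rewrite xy mdistxx subr0 ger0_norm ?mdist_ge0 //.
by have [_ _ _ _ /=] := wP N; lra.
Qed.

Lemma equicontinuous_iter n : exists2 d, 0 < d & forall x y, mdist x y < d ->
  forall i : int, (`|i| < n)%N -> mdist (ziter f i x) (ziter f i y) <= c.
Proof.
elim: n => [|n [d d0 dP]]; first by exists 1.
have [d1 d10 d1P] := compact_unif_continuous X_compact
  (@ziter_continuous _ f n%:Z) c_gt0.
have [d2 d20 d2P] := compact_unif_continuous X_compact
  (@ziter_continuous _ f (- n%:Z)) c_gt0.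
exists (Num.min d (Num.min d1 d2)); first by rewrite !lt_min d0 d10.
move=> x y; rewrite !lt_min => /and3P[xd xd1 xd2] i.
rewrite ltnS leq_eqVlt => /orP[/eqP iE|]; last exact: dP.
have [->|->] : i = n%:Z \/ i = - n%:Z by lia.
  exact/ltW/d1P.
exact/ltW/d2P.
Qed.

Section size.
Variable lam : R.
Hypothesis lam01 : 0 < lam < 1.

Let lam_gt0 n : 0 < lam ^+ n.
Proof. by case/andP: lam01 => ? _; exact: exprn_gt0. Qed.

Let lam_le m n : (m <= n)%N -> lam ^+ n <= lam ^+ m.
Proof.
by move=> mn; case/andP: lam01 => l0 l1; rewrite ler_wiXn2l // ltW.
Qed.

(** Equal to [lam ^+ N] for the largest [N] up to which [A] is small, and to [0]
    if there is no largest one. *)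
Definition dsize (A : set X) : R := inf [set lam ^+ n | n in small ^~ A].

Lemma dsize_ge0 A : 0 <= dsize A.
Proof.
apply: lb_le_inf; first by exists (lam ^+ 0), 0%N.
by move=> _ [n _ <-]; exact: ltW.
Qed.

Lemma dsize_le n A : small n A -> dsize A <= lam ^+ n.
Proof.
move=> sA; apply: ge_inf; last by exists n.
by exists 0 => _ [m _ <-]; exact: ltW.
Qed.

Lemma dsize_lt A r : dsize A < r -> exists2 n, small n A & lam ^+ n < r.
Proof.
move=> /inf_lt[|_ [n sn <-]]; last by exists n.
by exists (lam ^+ 0), 0%N.
Qed.

Lemma dsize_small n A : dsize A < lam ^+ n -> small n A.
Proof.
move=> /dsize_lt[k sk kn]; apply: small_leq sk.
by rewrite leqNgt; apply/negP => /ltnW/lam_le; rewrite leNgt kn.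
Qed.

Lemma dsize_set1 p : dsize [set p] = 0.
Proof.
apply/eqP; rewrite eq_le dsize_ge0 andbT; apply/ler_addgt0Pl => e e0.
have [n ne] := expr_small lam01 e0.
rewrite addr0 (le_trans _ (ltW ne)) //; apply: dsize_le => i _ x y -> ->.
by rewrite mdistxx ltW.
Qed.

Lemma dsize_diam e : 0 < e -> exists2 g, 0 < g & forall C, connected C ->
  dsize C < g -> forall x y, C x -> C y -> mdist x y < e.
Proof.
move=> /uniform_expansivity[m mP]; exists (lam ^+ m) => // C conC.
by move=> /dsize_small/mP; exact.
Qed.

Lemma diam_dsize e : 0 < e -> exists2 g, 0 < g & forall A,
  (forall x y, A x -> A y -> mdist x y < g) -> dsize A < e.
Proof.
move=> /(expr_small lam01)[n ne]; have [d d0 dP] := equicontinuous_iter n.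
exists d => // A Ad; apply: le_lt_trans ne; apply: dsize_le => i im x y Ax Ay.
by apply: dP => //; exact: Ad.
Qed.

Lemma dsize_eq0 C : connected C -> C !=set0 ->
  dsize C = 0 <-> exists x, C = [set x].
Proof.
move=> conC [x Cx]; split => [C0|[y ->]]; last exact: dsize_set1.
exists x; apply/seteqP; split => [y Cy|_ -> //].
apply/mdist_positivity/eqP; rewrite eq_le mdist_ge0 andbT.
apply/ler_addgt0Pl => e e0; rewrite addr0.
have [g g0 gP] := dsize_diam e0.
by apply/ltW/(gP C) => //; rewrite C0.
Qed.

(** If [A] is small up to time [m], then [f^n(A)] is small up to time [n + m]:
    an iterate [i] with [|i| < n + m] is [f^(i + n)] applied to [A], and either
    [0 <= i + n], where stability bounds it, or [|i + n| < m]. *)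
Lemma dsize_stable A n :
  (forall k : nat, forall x y, A x -> A y ->
     mdist (ziter f k%:Z x) (ziter f k%:Z y) <= c) ->
  dsize (ziter f n%:Z @` A) <= lam ^+ n * dsize A.
Proof.
move=> stA; rewrite -ler_pdivrMl //; apply: lb_le_inf.
  by exists (lam ^+ 0), 0%N.
move=> _ [m sA <-]; rewrite ler_pdivrMl // -exprD; apply: dsize_le.
move=> i im _ _ [x Ax <-] [y Ay <-]; rewrite -!ziterD.
have [i0|i0] := leP 0 (i + n%:Z).
  by rewrite -(gez0_abs i0); exact: stA.
by apply: sA => //; lia.
Qed.

Lemma dsize_unstable A n :
  (forall k : nat, forall x y, A x -> A y ->
     mdist (ziter f (- k%:Z) x) (ziter f (- k%:Z) y) <= c) ->
  dsize (ziter f (- n%:Z) @` A) <= lam ^+ n * dsize A.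
Proof.
move=> stA; rewrite -ler_pdivrMl //; apply: lb_le_inf.
  by exists (lam ^+ 0), 0%N.
move=> _ [m sA <-]; rewrite ler_pdivrMl // -exprD; apply: dsize_le.
move=> i im _ _ [x Ax <-] [y Ay <-]; rewrite -!ziterD.
have [i0|i0] := leP (i - n%:Z) 0.
  have -> : i - n%:Z = - `|i - n%:Z|%N%:Z by lia.
  exact: stA.
by apply: sA => //; lia.
Qed.

End size.

(** The time [m] comes from uniform expansivity at scale [c / 3]: if a connected
    set is small up to time [n], its iterates of order less than [n - m] have
    diameter below [c / 3], so a union of three meeting such sets is small up
    to time [n - m].  This costs a factor [lam ^- m <= 2]. *)
Lemma dsize_union3 : exists2 lam : R, 0 < lam < 1 & forall (A B C : set X) h,
  connected A -> connected B -> connected C ->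
  A `&` B !=set0 -> B `&` C !=set0 ->
  dsize lam A <= h -> dsize lam B <= h -> dsize lam C <= h ->
  dsize lam (A `|` B `|` C) <= 2 * h.
Proof.
have c3 : 0 < c / 3 by rewrite divr_gt0.
have [m mP] := uniform_expansivity c3.
have [lam lam01 lamm] := half_root (R := R) m.
exists lam => // A B C h conA conB conC [p [Ap Bp]] [q [Bq Cq]] Ah Bh Ch.
have l0 : 0 < lam by case/andP: lam01.
have l1 : lam <= 1 by case/andP: lam01 => _ /ltW.
apply/ler_addgt0Pl => e e0.
have he D : dsize lam D <= h -> exists2 n, small n D & lam ^+ n < h + e / 2.
  move=> Dh; apply: dsize_lt; apply: le_lt_trans Dh _.
  by rewrite ltrDl divr_gt0.
have [[a sA ah] [b sB bh] [d sC dh]] := And3 (he A Ah) (he B Bh) (he C Ch).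
have [n [na nb nd nh]] : exists n,
    [/\ (n <= a)%N, (n <= b)%N, (n <= d)%N & lam ^+ n < h + e / 2].
  exists (minn a (minn b d)); split; [clear; lia|clear; lia|clear; lia|].
  by rewrite /minn; do 2 case: ifP => // _.
have third D : connected D -> small n D -> forall i : int, (`|i| < n - m)%N ->
    forall x y, D x -> D y -> mdist (ziter f i x) (ziter f i y) < c / 3.
  move=> conD sD i im x y Dx Dy.
  have conD' := image_connected (@ziter_continuous _ f i) conD.
  apply: (mP _ conD' _ _ _ (imageP _ Dx) (imageP _ Dy)) => j jm.
  move=> _ _ [u Du <-] [v Dv <-]; rewrite -!ziterD.
  by apply: sD => //; clear -im jm; lia.
have sU : small (n - m) (A `|` B `|` C).
  have dA := third A conA (small_leq na sA).
  have dB := third B conB (small_leq nb sB).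
  have dC := third C conC (small_leq nd sC).
  move=> i im.
  (* Every point of the union is c/3-close to B at time i, through p or q. *)
  have toB x : (A `|` B `|` C) x ->
      exists2 z, B z & mdist (ziter f i x) (ziter f i z) < c / 3.
    move=> [[Ax|Bx]|Cx].
    - by exists p => //; exact: dA.
    - by exists x => //; exact: dB.
    - by exists q => //; exact: dC.
  move=> x y /toB[z Bz xz] /toB[w Bw yw].
  have zw := dB i im _ _ Bz Bw.
  have := metric_triangle (ziter f i x) (ziter f i z) (ziter f i y).
  have := metric_triangle (ziter f i z) (ziter f i w) (ziter f i y).
  rewrite (metric_sym (ziter f i y)) in yw; lra.
have := dsize_le lam01 sU.
have : lam ^+ (n - m) * lam ^+ m <= lam ^+ n.
  by rewrite -exprD ler_wiXn2l //; [exact: ltW|clear; lia].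
have : lam ^+ (n - m) * (1 / 2) <= lam ^+ (n - m) * lam ^+ m.
  by rewrite ler_wpM2l // exprn_ge0 // ltW.
clear -nh; lra.
Qed.

End expansive.

(** * The hyperbolic metric *)

Theorem theorem2p3 (R : realType) (X : metricType R)
    (X_compact : compact [set: X]) (f : homeo X) (f_cw : cw_expansive f) :
  exists D : marked_continuum X -> R,
    (* (1) metric properties *)
    [/\ forall (C : continuum X) (p q : X) (pC : C p) (qC : C q),
          0 <= D (Mark C p q pC qC) /\
          (D (Mark C p q pC qC) = 0 <-> exists x : X, C = [set x] :> set X),
        forall (C : continuum X) (p q : X) (pC : C p) (qC : C q),
          D (Mark C p q pC qC) = D (Mark C q p qC pC)
      & forall (A B : continuum X) (a b c : X)
            (aA : A a) (bA : A b) (bB : B b) (cB : B c),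
          D (markU A B a b c aA bA bB cB) <=
            D (Mark A a b aA bA) + D (Mark B b c bB cB)] /\
    (* (2) hyperbolicity *)
    (exists lambda epsilon : R,
      [/\ 0 < lambda < 1,
          0 < epsilon,
          forall (C : continuum X) (p q : X) (pC : C p) (qC : C q),
            Cs f epsilon C ->
            forall n : nat,
              D (mark_image f n%:Z (Mark C p q pC qC)) <=
                4 * lambda ^+ n * D (Mark C p q pC qC)
        & forall (C : continuum X) (p q : X) (pC : C p) (qC : C q),
            Cu f epsilon C ->
            forall n : nat,
              D (mark_image f (- n%:Z) (Mark C p q pC qC)) <=
                4 * lambda ^+ n * D (Mark C p q pC qC)]) /\
    (* (3) compatibility *)
    (forall delta : R, 0 < delta -> exists gamma : R, 0 < gamma /\
      forall C : continuum X,
        (diam C < gamma ->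
           forall (p q : X) (pC : C p) (qC : C q),
             D (Mark C p q pC qC) < delta) /\
        ((exists (p q : X) (pC : C p) (qC : C q),
             D (Mark C p q pC qC) < gamma) ->
           diam C < delta)).
Proof.
have [c c0 c_cw] := f_cw.
have [lam lam01 union3] := dsize_union3 X_compact c0 c_cw.
pose rho := dsize f c lam.
have rho0 := dsize_ge0 f c lam01.
have rho1 := dsize_set1 f c0 lam01.
have rho_eq0 := dsize_eq0 X_compact c0 c_cw lam01.
have Dle (C : continuum X) p q pC qC :
    chain_metric rho (@Mark _ C p q pC qC) <= rho C.
  exact: chain_metric_le_rho.
have leD (C : continuum X) p q pC qC :
    rho C <= 2 * chain_metric rho (@Mark _ C p q pC qC).
  exact: rho_le_chain_metric.
have D0 e : 0 <= chain_metric rho e by exact: chain_metric_ge0.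
have lam_ge0 n : 0 <= lam ^+ n.
  by case/andP: lam01 => l0 _; rewrite exprn_ge0 // ltW.
have hyperbolic i n (C : continuum X) p q (pC : C p) (qC : C q) :
    rho (ziter f i @` C) <= lam ^+ n * rho C ->
    chain_metric rho (mark_image f i (Mark C p q pC qC)) <=
      4 * lam ^+ n * chain_metric rho (Mark C p q pC qC).
  move=> h; apply: le_trans (le_trans h _).
    exact: Dle (continuum_image f i C) _ _ (imageP _ pC) (imageP _ qC).
  have := D0 (Mark C p q pC qC); have := leD C p q pC qC.
  move: (lam_ge0 n) (chain_metric _ _) => l0 d hd d0.
  have : lam ^+ n * rho C <= lam ^+ n * (2 * d) by rewrite ler_wpM2l.
  have : 0 <= lam ^+ n * d by rewrite mulr_ge0.
  lra.
have stable i (C : continuum X) : diam (continuum_image f i C) <= c ->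
    forall x y, C x -> C y -> mdist (ziter f i x) (ziter f i y) <= c.
  move=> dC x y Cx Cy.
  have := continuum_neq0 (continuum_image f i C).
  by move=> /(diam_leP c X_compact)[+ _]; apply => //; exact: imageP.
exists (chain_metric rho); split; [split|split].
- move=> C p q pC qC; split => //.
  rewrite -(rho_eq0 C (@continuum_connected _ C) (continuum_neq0 C)).
  have := rho0 C; have := D0 (Mark C p q pC qC).
  have := leD C p q pC qC; have := Dle C p q pC qC; rewrite /rho.
  by move=> *; split => ?; lra.
- by move=> C p q pC qC; exact: chain_metric_sym.
- by move=> A B a b d aA bA bB dB; exact: chain_metric_triangle.
(* The expansivity constant itself serves as epsilon. *)
- exists lam, c; split => // C p q pC qC stC n; apply: hyperbolic.
    by apply: dsize_stable => // k; exact: stable (stC k).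
  by apply: dsize_unstable => // k; exact: stable (stC k).
- move=> delta delta0; have d20 : 0 < delta / 2 by rewrite divr_gt0.
  have [g1 g10 g1P] := diam_dsize X_compact f c0 lam01 delta0.
  have [g2 g20 g2P] := dsize_diam X_compact c_cw lam01 d20.
  (* dsize C <= 2 D, so D < g2 / 2 makes dsize C smaller than g2. *)
  exists (Num.min g1 (g2 / 2)); split; first by rewrite lt_min g10 divr_gt0.
  move=> C; split=> [|[p [q [pC [qC]]]]]; rewrite lt_min => /andP[Cg1 Cg2].
    move=> p q pC qC; apply: le_lt_trans (Dle _ _ _ _ _) _.
    apply: g1P => x y Cx Cy; apply: le_lt_trans Cg1.
    by apply: (diam_leP _ X_compact (continuum_neq0 C)).1.
  apply: (@le_lt_trans _ _ (delta / 2)); last lra.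
  apply/(diam_leP _ X_compact (continuum_neq0 C)) => x y Cx Cy.
  apply/ltW/(g2P C) => //; first exact: continuum_connected.
  by apply: le_lt_trans (leD _ _ _ pC qC) _; lra.
Qed.
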